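(* There exist absolute constants $c, C > 0$ such that for all positive integers $m$ and all nonnegative integers $n$ with $n \le m^2-2$, the $L^1$ intrinsic diameter of the labeled configuration space $\widetilde{\mathrm{sq}}(n;m)$ lies between $c\,nm$ and $C\,nm$, and the $L^1$ extrinsic diameter of $\widetilde{\mathrm{sq}}(n;m)$ also lies between $c\,nm$ and $C\,nm$. (That is, the $L^1$ intrinsic diameter grows as $\Theta(nm)$, matching the $L^1$ extrinsic diameter up to a constant factor.)
   Context: $\widetilde{\mathrm{sq}}(n;m)$ is the set of all ways to place $n$ pieces, numbered $1,\dots,n$, in distinct positions (cells) of the $m \times m$ square grid. Two cells are adjacent if they share an edge. A hole is an unoccupied cell. $L^1$ intrinsic metric: two configurations are adjacent (at distance $1$) if they differ by moving one piece into a hole adjacent to it. The $L^1$ intrinsic metric is the graph metric generated by this relation. $L^1$ extrinsic metric: the distance between two configurations is the sum over all pieces of the distance along the grid (graph distance in the grid) between the two positions of that piece. The diameter with respect to a metric is the supremum of distances between pairs of configurations. *)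

(* Defs.v *)
From mathcomp Require Import all_boot all_order all_algebra.
From mathcomp Require Import classical_sets reals ereal.

Set Implicit Arguments.
Unset Strict Implicit.
Unset Printing Implicit Defensive.

Import Order.TTheory GRing.Theory Num.Theory.
Local Open Scope classical_set_scope.
Local Open Scope ring_scope.

(* Distances are extended reals: the infimum over an empty set of walks is +oo,
   so points in different components are infinitely far apart. *)
Definition graph_dist (R : realType) (T : eqType) (e : rel T) (x y : T) :
    \bar R :=
  ereal_inf [set (size p)%:R%:E | p in [set p | path e x p /\ last x p = y]].

Definition diameter (R : realType) (T : Type) (d : T -> T -> \bar R) : \bar R :=
  ereal_sup [set d xy.1 xy.2 | xy in [set: T * T]].

Notation cell m := ('I_m * 'I_m)%type.

Definition cell_adj (m : nat) : rel (cell m) := fun x y =>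
     ((x.1 == y.1) && ((x.2.+1 == y.2 :> nat) || (y.2.+1 == x.2 :> nat)))
  || ((x.2 == y.2) && ((x.1.+1 == y.1 :> nat) || (y.1.+1 == x.1 :> nat))).

Notation config n m := {f : {ffun 'I_n -> cell m} | injectiveb f}.

Definition pos (n m : nat) (x : config n m) (i : 'I_n) : cell m := val x i.

Definition hole (n m : nat) (x : config n m) (a : cell m) : bool :=
  [forall i, pos x i != a].

Definition config_adj (n m : nat) : rel (config n m) := fun x y =>
  [exists i, [&& cell_adj (pos x i) (pos y i), hole x (pos y i)
                & [forall j, (j != i) ==> (pos y j == pos x j)]]].

Definition intrinsic_dist (R : realType) (n m : nat) (x y : config n m) :
    \bar R :=
  graph_dist R (@config_adj n m) x y.

Definition extrinsic_dist (R : realType) (n m : nat) (x y : config n m) :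
    \bar R :=
  (\sum_(i < n) graph_dist R (@cell_adj m) (pos x i) (pos y i))%E.

(* Main.v *)
Require Import Defs.
From mathcomp Require Import all_boot all_order all_algebra.
From mathcomp Require Import classical_sets reals ereal.
From mathcomp Require Import perm zify.

(** Both lower bounds come from one pair of configurations.  Rotating the rows
of the grid by m/2 moves every piece by at least m/2 - 1/2 rows
([far_config]), and neither a step of one piece along the grid nor a move of a
configuration can change the sum of the row gaps by more than one
([extrinsic_ge], [intrinsic_ge]).  The extrinsic upper bound holds because
every cell is within 2m of every other one.

The intrinsic upper bound has two stages, each of cost O(nm).

In the first stage the pieces are treated as indistinguishable.  Along a grid
path from an occupied cell a to a hole b, the occupied set can be changed from
S to S - a + b by one move for each edge of the path, whatever stands in
between, since a piece in the way can take over the role of the moving one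
([slide]).  At most n such slides, of length at most 2m, turn the holes of any
configuration into those of any other one ([match_holes]).  Both given
configurations are brought in this way to the same set of holes, which is
chosen to contain the corner cells p = (0,0) and q = (0,1).

It remains to realise a permutation of the pieces, that is, at most n
transpositions, each at cost O(m) ([swap_pieces]).  A transposition of the
pieces at s and t is a conjugate: carry s and t, together with the two holes,
into one 2 x 2 block; exchange the two pieces there by turning them around the
block; then undo the carrying, which puts every other piece back where it was.
No other piece has to be kept in place meanwhile, so nothing depends on how
dense the configuration is.

For the carrying, the two holes and a companion piece travel as a 2 x 2 block,
one row or column at a time, with a bounded number of moves for each step, and
they pick up the target when it comes into reach ([carry]).  This is done twice
([gather]): first with an arbitrary companion and target s, then with companion
s and target t.  The steps take place in 2 x 3 and 3 x 2 boxes, where an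
exhaustive search finds the moves.

To make conjugation available, moves are described by words of swaps of
adjacent cells, one of which is a hole.  Such a word permutes the whole grid,
and its legality depends only on two designated holes p and q, so the same word
can be run in any configuration in which p and q are empty ([run_word]). *)

Set Implicit Arguments.
Unset Strict Implicit.
Unset Printing Implicit Defensive.

Import Order.TTheory GRing.Theory Num.Theory.

(** * Words of swaps *)

Local Notation pt := (nat * nat)%type.

Definition adj : rel pt := fun u v =>
     ((u.1 == v.1) && ((u.2.+1 == v.2) || (v.2.+1 == u.2)))
  || ((u.2 == v.2) && ((u.1.+1 == v.1) || (v.1.+1 == u.1))).

Definition swap (T : eqType) (u v c : T) : T :=
  if c == u then v else if c == v then u else c.

Definition act (w : seq (pt * pt)) (c : pt) : pt :=
  foldl (fun c uv => swap uv.1 uv.2 c) c w.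

(** The designated holes [p] and [q] are carried along by the swaps.  When both
cells of a swap are holes, the swap is legal and corresponds to no move. *)
Fixpoint legal (D : pred pt) (p q : pt) (w : seq (pt * pt)) : bool :=
  if w is (u, v) :: w' then
    [&& adj u v, D u, D v, (u == p) || (u == q)
      & legal D (swap u v p) (swap u v q) w']
  else true.

Definition box (h l : nat) : pred pt := fun c => (c.1 < h) && (c.2 < l).
Definition block (b : pt) : pred pt :=
  fun c => (b.1 <= c.1 <= b.1.+1) && (b.2 <= c.2 <= b.2.+1).
Definition cells (h l : nat) : seq pt :=
  [seq (i, j) | i <- iota 0 h, j <- iota 0 l].
Definition shift (o c : pt) : pt := (o.1 + c.1, o.2 + c.2).

Lemma mem_cells h l c : (c \in cells h l) = box h l c.
Proof.
case: c => a b; apply/allpairsP/idP => [[[i j] /= []]|].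
  by rewrite !mem_iota /box /= => hi hj [-> ->]; rewrite hi hj.
case/andP=> /= ha hb.
by exists (a, b); rewrite !mem_iota /=.
Qed.

Lemma swapK (T : eqType) (u v : T) : involutive (swap u v).
Proof.
move=> c; rewrite /swap; case: (eqVneq c u) => [->|cu].
  by case: (eqVneq v u) => [->|]; rewrite ?eqxx.
case: (eqVneq c v) => [->|cv]; first by rewrite eqxx.
by rewrite (negbTE cu) (negbTE cv).
Qed.

Definition swap_inj (T : eqType) (u v : T) := inv_inj (swapK u v).

Lemma act_inj w : injective (act w).
Proof. by elim: w => [|[u v] w IH] c d //= /IH /swap_inj. Qed.

Lemma act_cat w1 w2 c : act (w1 ++ w2) c = act w2 (act w1 c).
Proof. exact: foldl_cat. Qed.

Lemma legal_cat D p q w1 w2 :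
  legal D p q (w1 ++ w2) =
  legal D p q w1 && legal D (act w1 p) (act w1 q) w2.
Proof.
by elim: w1 p q => [|[u v] w1 IH] p q //=; rewrite IH !andbA.
Qed.

Lemma act_region D p q w c : legal D p q w -> D c -> D (act w c).
Proof.
elim: w p q c => [|[u v] w IH] p q c //= /and5P[_ Du Dv _ lw] Dc.
by apply: IH lw _; rewrite /swap; case: ifP => // _; case: ifP.
Qed.

Lemma shift_inj o : injective (shift o).
Proof. by case: o => a b [c d] [e f] [] /= /addnI -> /addnI ->. Qed.

Lemma eq_shift o u v : (shift o u == shift o v) = (u == v).
Proof. exact: inj_eq (@shift_inj o) u v. Qed.

Definition shiftw (o : pt) (w : seq (pt * pt)) :=
  [seq (shift o uv.1, shift o uv.2) | uv <- w].

Lemma swap_shift o u v c :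
  swap (shift o u) (shift o v) (shift o c) = shift o (swap u v c).
Proof. by rewrite /swap !eq_shift; do 2?case: ifP. Qed.

Lemma act_shift o w c : act (shiftw o w) (shift o c) = shift o (act w c).
Proof. by elim: w c => [|[u v] w IH] c //=; rewrite swap_shift IH. Qed.

Lemma legal_shift o (D D' : pred pt) p q w :
  (forall c, D c -> D' (shift o c)) -> legal D p q w ->
  legal D' (shift o p) (shift o q) (shiftw o w).
Proof.
move=> DD'; elim: w p q => [|[u v] w IH] p q //= /and5P[auv Du Dv upq lw].
apply/and5P; split; rewrite ?DD' //.
- by move: auv; rewrite /adj /= -!addnS !eqn_add2l.
- by rewrite !eq_shift.
- by rewrite !swap_shift IH.
Qed.

Lemma act_shift_out o D p q w c :
  legal D p q w -> (forall d, D d -> c != shift o d) -> act (shiftw o w) c = c.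
Proof.
move=> + cD; elim: w p q => [|[u v] w IH] p q //= /and5P[_ Du Dv _ lw].
have -> : swap (shift o u) (shift o v) c = c.
  by rewrite /swap (negbTE (cD _ Du)) (negbTE (cD _ Dv)).
exact: IH lw.
Qed.

(** * Puzzles in a small box, solved by search *)

(** Depth-first search for a legal word of length at most [k] that brings the
holes [p], [q] and the tracked cells [s] to a position satisfying [goal]. *)
Fixpoint solve (h l k : nat) (goal : pt -> pt -> seq pt -> bool)
    (p q : pt) (s : seq pt) : bool :=
  if goal p q s then true else
  if k is k'.+1 then
    has (fun u => has (fun v =>
        solve h l k' goal (swap u v p) (swap u v q) [seq swap u v c | c <- s])
      [seq v <- cells h l | adj u v]) [:: p; q]
  else false.

Lemma solveP h l k goal p q s :
  solve h l k goal p q s -> box h l p -> box h l q ->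
  exists w, [/\ legal (box h l) p q w, size w <= k
    & goal (act w p) (act w q) [seq act w c | c <- s]].
Proof.
elim: k p q s => [|k IH] p q s /=.
  case: ifP => // g _ _ _; exists [::]; split => //=.
  by rewrite /act /= map_id.
case: ifP => [g _ _ _|_].
  exists [::]; split => //=.
  by rewrite /act /= map_id.
rewrite orbF => /orP H Bp Bq.
have [u [upq /hasP[v]]] : exists u, (u == p) || (u == q) /\ has (fun v =>
   solve h l k goal (swap u v p) (swap u v q) [seq swap u v c | c <- s])
   [seq v <- cells h l | adj u v].
  by case: H => H; [exists p | exists q]; rewrite eqxx ?orbT.
rewrite mem_filter mem_cells => /andP[auv Bv] /IH [].
- by rewrite /swap; case: ifP => // _; case: ifP => // _; case/orP: upq => /eqP->.
- by rewrite /swap; case: ifP => // _; case: ifP => // _; case/orP: upq => /eqP->.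
move=> w [lw sw gw]; exists ((u, v) :: w); split => //=.
  by rewrite auv Bv upq lw !andbT /=; case/orP: upq => /eqP->.
by move: gw; rewrite -map_comp.
Qed.

Arguments solve : simpl never.

(** One step of the travelling block, from the corner [b] to the adjacent corner
[b'], inside a box that is the union of the two blocks: the holes and the
companion [s] can make the step, and if the box contains the target [t], all
four can be collected in one of the two blocks.  Six moves are the maximum for
the first task and four for the second. *)
Definition carry_check (h l : nat) (b b' : pt) : bool :=
  let L := [seq c <- cells h l | block b c] in
  all (fun p => all (fun q => all (fun s =>
    if uniq [:: p; q; s] then
      if solve h l 6 (fun p q s => all (block b') [:: p, q & s]) p q [:: s]
      then all (fun t => if t \in [:: p; q] then true else
        solve h l 4 (fun p q s => if all (block b) [:: p, q & s] then true
                     else all (block b') [:: p, q & s]) p q [:: s; t])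
        (cells h l)
      else false
    else true) L) L) L.

(** Two pieces in a 2 x 2 block with two holes can be exchanged: they go around
the block until each is at the place of the other.  The second test says that
the four cells fill the block, so that nothing else is displaced. *)
Definition exchange_check : bool :=
  all (fun p => all (fun q => all (fun s => all (fun t =>
    if uniq [:: p; q; s; t] then
      if all (mem [:: p; q; s; t]) (cells 2 2)
      then solve 2 2 4 (fun _ _ c => c == [:: t; s]) p q [:: s; t] else false
    else true) (cells 2 2)) (cells 2 2)) (cells 2 2)) (cells 2 2).

Lemma carry_right : carry_check 2 3 (0, 0) (0, 1).
Proof. by lazy. Qed.
Lemma carry_left : carry_check 2 3 (0, 1) (0, 0).
Proof. by lazy. Qed.
Lemma carry_down : carry_check 3 2 (0, 0) (1, 0).
Proof. by lazy. Qed.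
Lemma carry_up : carry_check 3 2 (1, 0) (0, 0).
Proof. by lazy. Qed.
Lemma exchange_small : exchange_check.
Proof. by lazy. Qed.

(** * Carrying two cells to the holes *)

Lemma shift_ex o c : (o.1 <= c.1) && (o.2 <= c.2) -> exists d, c = shift o d.
Proof.
case: o c => a b [r s] /= /andP[ar bs].
by exists (r - a, s - b); rewrite /shift /= !subnKC.
Qed.

Lemma block_shift o b c : block (shift o b) (shift o c) = block b c.
Proof. by rewrite /block /= -!addnS !leq_add2l. Qed.

(** The two cases are whether or not the target lies in the box of the step; if
it does not, the step leaves it where it is. *)
Lemma carry_step h l b b' o m p q s t :
  carry_check h l b b' ->
  box h l (b.1.+1, b.2.+1) -> box h l (b'.1.+1, b'.2.+1) ->
  (forall c, box h l c -> box m m (shift o c)) ->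
  uniq [:: p; q; s] -> all (block (shift o b)) [:: p; q; s] ->
  t \notin [:: p; q] ->
  exists w, [/\ legal (box m m) p q w, size w <= 6 &
    (exists b0, box m m (b0.1.+1, b0.2.+1) /\ all (block b0) [seq act w c | c <- [:: p; q; s; t]]) \/
    (act w t = t /\ all (block (shift o b')) [seq act w c | c <- [:: p; q; s]])].
Proof.
move=> chk bl bl' obox.
have bbox c : block b c -> box h l c.
  by case/andP: bl; rewrite /block /box /=; lia.
have ex c : block (shift o b) c -> exists2 d, block b d & c = shift o d.
  move=> Hc; have [d cd] : exists d, c = shift o d.
    by apply: shift_ex; move: Hc; rewrite /block /shift /=; lia.
  by exists d => //; rewrite -(block_shift o) -cd.
move=> + Bpqs; case/and4P: Bpqs => /ex[p0 Bp ->] /ex[q0 Bq ->] /ex[s0 Bs ->] _.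
rewrite /= !inE !eq_shift andbT => upqs tpq.
have mem c : block b c -> c \in [seq c <- cells h l | block b c].
  by move=> Bc; rewrite mem_filter Bc mem_cells bbox.
move: chk => /allP /(_ _ (mem _ Bp)) /allP /(_ _ (mem _ Bq)).
move=> /allP /(_ _ (mem _ Bs)); rewrite /= !inE !andbT upqs.
case: ifP => // /solveP /(_ (bbox _ Bp) (bbox _ Bq)) [w [lw sw gw]] /allP absorb.
have [/hasP[d] | nbox] := boolP (has (fun d => t == shift o d) (cells h l)).
  move=> dbox td; have {absorb} := absorb _ dbox.
  move: tpq; rewrite (eqP td) !eq_shift !inE => /negbTE ->.
  move=> /solveP /(_ (bbox _ Bp) (bbox _ Bq)) [w' [lw' sw' gw']].
  exists (shiftw o w'); split.
  - exact: legal_shift lw'.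
  - by rewrite size_map (leq_trans sw').
  left; move: gw'; rewrite /= !act_shift.
  case: ifP => [? _|_ ?]; [exists (shift o b)|exists (shift o b')];
    rewrite !block_shift; split=> //;
    [have := obox _ bl | have := obox _ bl']; by rewrite /shift /= !addnS.
exists (shiftw o w); split; first exact: legal_shift lw.
  by rewrite size_map.
right; split; last by move: gw; rewrite /= !act_shift !block_shift.
apply: act_shift_out lw _ => d dbox.
by move/hasPn: nbox; apply; rewrite mem_cells.
Qed.

Lemma uniq3_act w p q s : uniq [:: p; q; s] -> uniq [:: act w p; act w q; act w s].
Proof. by move=> u; rewrite (map_inj_uniq (@act_inj w) [:: p; q; s]). Qed.

(** Induction on the distance from the corner of the block to the target.  A
target outside the block is beyond one of its four sides, and the block then
steps towards that side, which stays inside the grid. *)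
Lemma carry m i j p q s t D :
  uniq [:: p; q; s] -> all (block (i, j)) [:: p; q; s] ->
  i.+1 < m -> j.+1 < m -> box m m t -> t \notin [:: p; q] ->
  (i - t.1) + (t.1 - i) + (j - t.2) + (t.2 - j) <= D ->
  exists w, [/\ legal (box m m) p q w, size w <= 6 * D &
    exists b, box m m (b.1.+1, b.2.+1) /\
      all (block b) [seq act w c | c <- [:: p; q; s; t]]].
Proof.
elim: D i j p q s => [|D IH] i j p q s upqs Bpqs im jm tm tpq dt.
  exists [::]; split => //; exists (i, j); split; first exact/andP.
  by move: Bpqs; rewrite /= /block /=; lia.
have [Bt|nBt] := boolP (block (i, j) t).
  exists [::]; split => //; exists (i, j); split; first exact/andP.
  by case/and4P: Bpqs => /= -> -> -> _; rewrite Bt.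
have {nBt dt} [h [l [b [b' [o [chk bl bl' obox [ob dt]]]]]]] :
  exists h l b b' o, [/\ carry_check h l b b', box h l (b.1.+1, b.2.+1),
    box h l (b'.1.+1, b'.2.+1), forall c, box h l c -> box m m (shift o c) &
    shift o b = (i, j) /\
    ((shift o b').1 - t.1) + (t.1 - (shift o b').1) +
      ((shift o b').2 - t.2) + (t.2 - (shift o b').2) <= D].
  case/andP: tm nBt dt => rm cm; rewrite /block /= => nB dt.
  have [cj|jc] := ltnP t.2 j.
    case: j jm {Bpqs} nB dt cj => // j *; exists 2, 3, (0, 1), (0, 0), (i, j).
    split; rewrite ?carry_left // /shift /=; last by rewrite ?addn0 ?addn1; split => //; lia.
    by move=> d; rewrite /box /=; lia.
  have [ri|ir] := ltnP t.1 i.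
    case: i im {Bpqs} nB dt ri => // i *; exists 3, 2, (1, 0), (0, 0), (i, j).
    split; rewrite ?carry_up // /shift /=; last by rewrite ?addn0 ?addn1; split => //; lia.
    by move=> d; rewrite /box /=; lia.
  have [jc'|cj'] := ltnP j.+1 t.2.
    exists 2, 3, (0, 0), (0, 1), (i, j).
    split; rewrite ?carry_right // /shift /=; last by rewrite ?addn0 ?addn1; split => //; lia.
    by move=> d; rewrite /box /=; lia.
  exists 3, 2, (0, 0), (1, 0), (i, j).
  split; rewrite ?carry_down // /shift /=; last by rewrite ?addn0 ?addn1; split => //; lia.
  by move=> d; rewrite /box /=; lia.
rewrite -ob in Bpqs.
have [w [lw sw [? | [tw Bw]]]] := carry_step chk bl bl' obox upqs Bpqs tpq.
  by exists w; split => //; rewrite mulnS (leq_trans sw) ?leq_addr.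
have [] := IH (shift o b').1 (shift o b').2 (act w p) (act w q) (act w s).
- exact: uniq3_act.
- by rewrite -surjective_pairing.
- by have /andP[+ _] := obox _ bl'; rewrite /shift /= addnS.
- by have /andP[_ +] := obox _ bl'; rewrite /shift /= addnS.
- by [].
- by rewrite -tw; move: tpq; rewrite !inE !(inj_eq (@act_inj w)).
- by [].
move=> w' [lw' sw' [b0 [mb0 Bb0]]]; exists (w ++ w'); split.
- by rewrite legal_cat lw.
- by rewrite size_cat mulnS leq_add.
by exists b0; split => //; rewrite /= !act_cat tw; exact: Bb0.
Qed.

(** In the first use of [carry] the companion is the cell (1, 0), which completes
p and q to three cells of the corner block.  Each use covers a distance of at
most 2m, whence 24 = 2 * 6 * 2. *)
Lemma gather m p q s t :
  p = (0, 0) -> q = (0, 1) -> 1 < m -> uniq [:: p; q; s; t] -> box m m s -> box m m t ->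
  exists w, [/\ legal (box m m) p q w, size w <= 24 * m &
    exists b, box m m (b.1.+1, b.2.+1) /\
      all (block b) [seq act w c | c <- [:: p; q; s; t]]].
Proof.
move=> p0 q0 m1 upqst sm tm.
have [spq tpq] : s \notin [:: p; q] /\ t \notin [:: p; q].
  move: upqst; rewrite /= !inE !negb_or => /and4P[/and3P[_ ps pt] /andP[qs qt] _ _].
  by rewrite ![s == _]eq_sym ![t == _]eq_sym ps qs pt qt.
have [] := @carry m 0 0 p q (1, 0) s (2 * m) => //.
- by rewrite p0 q0.
- by rewrite p0 q0.
- by case/andP: sm; lia.
move=> w [lw sw [b [mb /= /and5P[Bp Bq _ Bs _]]]].
have us : uniq [:: act w p; act w q; act w s].
  by apply: uniq3_act; rewrite (uniq_catC [:: p; q] [:: s]) cons_uniq spq p0 q0.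
have tm' := act_region lw tm.
have [] := @carry m b.1 b.2 (act w p) (act w q) (act w s) (act w t) (2 * m) => //.
- by rewrite -surjective_pairing /= Bp Bq Bs.
- by case/andP: mb.
- by case/andP: mb.
- by move: tpq; rewrite !inE !(inj_eq (@act_inj w)).
- case/andP: tm' => t1 t2; case/andP: mb => /= b1 b2.
  move: t1 t2 b1 b2; clear; lia.
move=> w' [lw' sw' [b' [mb' Bb']]]; exists (w ++ w'); split.
- by rewrite legal_cat lw.
- by rewrite size_cat; move: sw sw'; clear; lia.
by exists b'; split => //; rewrite /= !act_cat.
Qed.

(** The displacement of p and q is left open: they are holes, hence only their
union matters. *)
Lemma exchange m b p q s t :
  box m m (b.1.+1, b.2.+1) -> all (block b) [:: p; q; s; t] ->
  uniq [:: p; q; s; t] ->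
  exists w, [/\ legal (box m m) p q w, size w <= 4, act w s = t, act w t = s &
    forall c, c \notin [:: p; q; s; t] -> act w c = c].
Proof.
move=> /andP[/= bm1 bm2] /= /and5P[Bp Bq Bs Bt _].
have ex c : block b c -> exists2 d, d \in cells 2 2 & c = shift b d.
  move=> Hc; have [d cd] : exists d, c = shift b d.
    by apply: shift_ex; move: Hc; rewrite /block; lia.
  by exists d => //; move: Hc; rewrite mem_cells cd /block /box /shift /=; lia.
have [[p0 Bp0 ->] [q0 Bq0 ->]] := (ex _ Bp, ex _ Bq).
have [[s0 Bs0 ->] [t0 Bt0 ->]] := (ex _ Bs, ex _ Bt).
move=> upqst; have {}upqst : uniq [:: p0; q0; s0; t0].
  by rewrite -(map_inj_uniq (@shift_inj b)).
have := exchange_small => /allP /(_ _ Bp0) /allP /(_ _ Bq0).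
move=> /allP /(_ _ Bs0) /allP /(_ _ Bt0).
cbv beta; rewrite upqst; case: ifP => // full /solveP [||w [lw sw /eqP[ws wt]]].
- by rewrite -mem_cells.
- by rewrite -mem_cells.
exists (shiftw b w); split; rewrite ?size_map ?act_shift ?ws ?wt //.
  apply: legal_shift lw => c; rewrite /box /shift /=.
  by move: bm1 bm2; clear; lia.
move=> c nc; apply: act_shift_out lw _ => d Bd; apply/eqP => cd.
move: (nc : c \notin [seq shift b x | x <- [:: p0; q0; s0; t0]]).
rewrite cd (mem_map (@shift_inj b)) => /negP; apply.
by apply: (allP full); rewrite mem_cells.
Qed.

(** * Bounded walks *)

Definition within (T : eqType) (e : rel T) (k : nat) (x y : T) : Prop :=
  exists p, [/\ path e x p, last x p = y & size p <= k].

Lemma within0 (T : eqType) (e : rel T) k x : within e k x x.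
Proof. by exists [::]. Qed.

Lemma within1 (T : eqType) (e : rel T) x y : e x y -> within e 1 x y.
Proof. by move=> exy; exists [:: y]; rewrite /= exy. Qed.

Lemma within_trans (T : eqType) (e : rel T) y k l x z :
  within e k x y -> within e l y z -> within e (k + l) x z.
Proof.
move=> [p [ep <- sp]] [q [eq <- sq]]; exists (p ++ q).
by rewrite cat_path last_cat size_cat ep leq_add.
Qed.

Lemma within_sym (T : eqType) (e : rel T) k x y :
  symmetric e -> within e k x y -> within e k y x.
Proof.
move=> esym [p [ep <- sp]]; exists (rev (belast x p)); split.
- by rewrite rev_path (eq_path (e' := e)) // => u v; rewrite esym.
- by case: p {ep sp} => //= a p; rewrite rev_cons last_rcons.
- by rewrite size_rev size_belast.
Qed.

Lemma within_le (T : eqType) (e : rel T) k l x y :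
  k <= l -> within e k x y -> within e l x y.
Proof. by move=> kl [p [ep lp sp]]; exists p; split => //; lia. Qed.

(** * Moves of configurations *)

Definition vcell (m : nat) (c : cell m) : pt := (val c.1, val c.2).

Lemma vcell_inj m : injective (@vcell m).
Proof. by case=> a b [c d] [] /val_inj -> /val_inj ->. Qed.

Lemma vcell_box m (c : cell m) : box m m (vcell c).
Proof. by rewrite /box !ltn_ord. Qed.

Lemma vcell_ex m c : box m m c -> exists d : cell m, vcell d = c.
Proof.
by case: c => a b /andP[/= am bm]; exists (Ordinal am, Ordinal bm).
Qed.

Lemma cell_adjE m (c d : cell m) : cell_adj c d = adj (vcell c) (vcell d).
Proof. by []. Qed.

Lemma cell_adj_sym m : symmetric (@cell_adj m).
Proof.
move=> c d; rewrite /cell_adj (eq_sym c.1) (eq_sym c.2).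
by rewrite (orbC (c.2.+1 == _)) (orbC (c.1.+1 == _)).
Qed.

Section Config.
Variables n m : nat.
Implicit Types (x y : config n m) (a b : cell m).

Lemma pos_inj x : injective (pos x).
Proof. by apply/injectiveP; exact: valP x. Qed.

Lemma config_ext x y : (forall i, pos x i = pos y i) -> x = y.
Proof. by move=> xy; apply/val_inj/ffunP. Qed.

Lemma config_of (f : 'I_n -> cell m) :
  injective f -> exists x, forall i, pos x i = f i.
Proof.
move=> f_inj; have fP : injectiveb (finfun f).
  by apply/injectiveP => i j; rewrite !ffunE; exact: f_inj.
by exists (exist _ (finfun f) fP) => i; rewrite /pos ffunE.
Qed.

Lemma holePn x a : reflect (exists i, pos x i = a) (~~ hole x a).
Proof.
apply: (iffP forallPn) => [[i]|[i <-]]; first by rewrite negbK => /eqP; exists i.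
by exists i; rewrite negbK.
Qed.

Lemma holeF x i : hole x (pos x i) = false.
Proof. by apply/negbTE/holePn; exists i. Qed.

Lemma hole_neq x a i : hole x a -> pos x i != a.
Proof. by move/forallP. Qed.

Lemma cell_adj_neq a b : cell_adj a b -> a != b.
Proof. by apply: contraTneq => ->; rewrite /cell_adj; lia. Qed.

Lemma config_adj_sym : symmetric (@config_adj n m).
Proof.
suff sub x y : config_adj x y -> config_adj y x by move=> x y; apply/idP/idP; exact: sub.
move=> /existsP[i /and3P[xyi hi /forallP xy]].
apply/existsP; exists i; apply/and3P; split.
- by rewrite cell_adj_sym.
- apply/forallP => j; have [->|ji] := eqVneq j i.
    by rewrite eq_sym cell_adj_neq.
  by rewrite (eqP (implyP (xy j) ji)) (inj_eq (@pos_inj x)).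
- apply/forallP => j; apply/implyP => ji.
  by rewrite eq_sym; exact: implyP (xy j) ji.
Qed.

Lemma move_piece x i b :
  hole x b -> cell_adj (pos x i) b ->
  exists y, [/\ within (@config_adj n m) 1 x y, pos y i = b &
    forall j, j != i -> pos y j = pos x j].
Proof.
move=> hb ab; have [j k|y yE] := @config_of (fun j => if j == i then b else pos x j).
  case: (eqVneq j i) => [->|ji]; case: (eqVneq k i) => [->|ki] //.
  - by move=> e; have := hole_neq k hb; rewrite -e eqxx.
  - by move=> e; have := hole_neq j hb; rewrite e eqxx.
  - exact: pos_inj.
have yi : pos y i = b by rewrite yE eqxx.
have yj j : j != i -> pos y j = pos x j by rewrite yE => /negbTE ->.
exists y; split => //; apply/within1/existsP; exists i.
rewrite yi ab hb; apply/forallP => j; apply/implyP => ji.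
by rewrite yj.
Qed.

(** A swap of a hole with an occupied cell is a move of the piece in that cell,
and a swap of two holes changes nothing. *)
Lemma run_word x p q w :
  (forall i, (vcell (pos x i) != p) && (vcell (pos x i) != q)) ->
  legal (box m m) p q w ->
  exists y, within (@config_adj n m) (size w) x y /\
    forall i, vcell (pos y i) = act w (vcell (pos x i)).
Proof.
elim: w x p q => [|[u v] w IH] x p q hpq /=.
  by exists x; split => //; exact: within0.
move=> /and5P[auv Du Dv upq lw].
have hu i : vcell (pos x i) != u.
  by case/andP: (hpq i) => hp hq; case/orP: upq => /eqP ->.
have [y [xy yE]] : exists y, within (@config_adj n m) 1 x y /\
    forall i, vcell (pos y i) = swap u v (vcell (pos x i)).
  have [/existsP[i /eqP iv]|/existsPn nv] := boolP [exists i, vcell (pos x i) == v].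
    have [b bu] := vcell_ex Du.
    have [||y [xy yi yj]] := @move_piece x i b.
    - by apply/forallP => j; rewrite -(inj_eq (@vcell_inj m)) bu.
    - by rewrite cell_adj_sym cell_adjE bu iv.
    exists y; split => // j; rewrite /swap (negbTE (hu j)).
    have [->|ji] := eqVneq j i; first by rewrite yi iv eqxx bu.
    by rewrite yj // -iv (inj_eq (@vcell_inj m)) (inj_eq (@pos_inj x)) (negbTE ji).
  exists x; split; first exact: within0.
  by move=> i; rewrite /swap (negbTE (hu i)) (negbTE (nv i)).
have [|z [yz zE]] := IH y _ _ _ lw.
  by move=> i; rewrite yE !(inj_eq (@swap_inj _ u v)).
exists z; split; first by rewrite -add1n; exact: within_trans xy yz.
by move=> i; rewrite zE yE.
Qed.

Lemma move_hole x a b :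
  hole x b -> cell_adj a b -> ~~ hole x a ->
  exists y, within (@config_adj n m) 1 x y /\
    forall c, hole y c = (c == a) || hole x c && (c != b).
Proof.
move=> hb ab /holePn[i ia].
have [|y [xy yi yj]] := @move_piece x i b hb; first by rewrite ia.
exists y; split => // c; apply/idP/idP.
  move=> /forallP hc; have := hc i; rewrite yi eq_sym => ->; rewrite andbT.
  case: eqVneq => //= ca; apply/forallP => j; have [->|ji] := eqVneq j i.
    by rewrite ia eq_sym.
  by rewrite -yj.
case/orP => [/eqP ->|/andP[hc cb]]; apply/forallP => j; have [->|ji] := eqVneq j i.
- by rewrite yi eq_sym cell_adj_neq.
- by rewrite yj // -ia (inj_eq (@pos_inj x)).
- by rewrite yi eq_sym.
- by rewrite yj //; exact: hole_neq.
Qed.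

(** If the next cell of the path is free, the piece steps into it and goes on;
if it is occupied, the piece standing there continues first, and the piece at
[a] then steps into the vacated cell. *)
Lemma slide x a p :
  path (@cell_adj m) a p -> ~~ hole x a -> hole x (last a p) ->
  exists y, within (@config_adj n m) (size p) x y /\
    forall c, hole y c = (c == a) || hole x c && (c != last a p).
Proof.
elim: p x a => [|b p IH] x a /=; first by move=> _ /negbTE ->.
case/andP=> ab bp na hl; have [hb|nb] := boolP (hole x b).
  have [x1 [xx1 h1]] := move_hole hb ab na.
  have [bl|bl] := eqVneq b (last b p).
    exists x1; split; last by rewrite -bl.
    by apply: within_le xx1.
  have al : last b p != a by apply: contraNneq na => <-.
  have [||y [x1y hy]] := IH x1 b bp.
  - by rewrite h1 eqxx andbF orbF eq_sym cell_adj_neq.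
  - by rewrite h1 hl (eq_sym (last b p) b) bl orbT.
  exists y; split; first by rewrite -add1n; exact: within_trans xx1 x1y.
  move=> c; rewrite hy h1; have [->|cb] /= := eqVneq c b.
    by rewrite hb bl orbT.
  have [->|ca] /= := eqVneq c a; first by rewrite eq_sym.
  by rewrite andbT.
have [x1 [xx1 h1]] := IH x b bp nb hl.
have [|||y [x1y hy]] := @move_hole x1 a b.
- by rewrite h1 eqxx.
- by [].
- by rewrite h1 (negbTE na) orbF cell_adj_neq.
exists y; split; first by rewrite -addn1; exact: within_trans xx1 x1y.
move=> c; rewrite hy h1; have [->|cb] /= := eqVneq c b; last by rewrite andbT.
by rewrite (negbTE nb).
Qed.

End Config.

Lemma grid_path m (a b : cell m) :
  within (@cell_adj m) (2 * m) a b.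
Proof.
suff gp D : forall a : cell m,
    ((a.1 : nat) - b.1) + (b.1 - a.1) + (a.2 - b.2) + (b.2 - a.2) <= D ->
    within (@cell_adj m) D a b.
  apply: gp; move: (ltn_ord a.1) (ltn_ord a.2) (ltn_ord b.1) (ltn_ord b.2).
  lia.
elim: D => {a} [|D IH] a dab.
  have -> : a = b by apply: vcell_inj; rewrite /vcell; congr pair => /=; lia.
  exact: within0.
have [<-|ab] := eqVneq a b; first exact: within0.
have [c ac dc] : exists2 c : cell m, cell_adj a c &
    ((c.1 : nat) - b.1) + (b.1 - c.1) + (c.2 - b.2) + (b.2 - c.2) <= D.
  suff [c [cm ac dc]] : exists c : pt, [/\ box m m c, adj (vcell a) c &
      (c.1 - b.1) + (b.1 - c.1) + (c.2 - b.2) + (b.2 - c.2) <= D].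
    have [d dc'] := vcell_ex cm; exists d; first by rewrite cell_adjE dc'.
    by move: dc; rewrite -dc'.
  have {}ab : ((a.1 : nat) != b.1) || ((a.2 : nat) != b.2).
    move: ab; rewrite -(inj_eq (@vcell_inj m)) -negb_and; apply: contraNN.
    by case/andP=> /eqP a1 /eqP a2; rewrite /vcell /= a1 a2.
  move: (ltn_ord a.1) (ltn_ord a.2) (ltn_ord b.1) (ltn_ord b.2) ab dab.
  rewrite /box /adj /vcell /=; clear IH.
  move: (nat_of_ord a.1) (nat_of_ord a.2) (nat_of_ord b.1) (nat_of_ord b.2).
  move=> a1 a2 b1 b2 am1 am2 bm1 bm2 ab dab.
  have [h|h] := ltnP a1 b1; first by exists (a1.+1, a2) => /=; split; lia.
  have [h1|h1] := ltnP b1 a1; first by exists (a1.-1, a2) => /=; split; lia.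
  have [h2|h2] := ltnP a2 b2; first by exists (a1, a2.+1) => /=; split; lia.
  by exists (a1, a2.-1) => /=; split; lia.
by rewrite -add1n; apply: within_trans (within1 ac) (IH _ dc).
Qed.

(** * Upper bound for the intrinsic distance *)

Section Upper.
Variables n m : nat.
Implicit Types (x y z : config n m).

Lemma card_occupied x : #|~: [set c | hole x c]| = n.
Proof.
have -> : ~: [set c | hole x c] = [set pos x i | i : 'I_n].
  apply/setP => c; rewrite !inE; apply/holePn/imsetP => [[i <-]|[i _ ->]].
    by exists i.
  by exists i.
by rewrite card_imset ?card_ord //; exact: pos_inj.
Qed.

Lemma card_holes x z : #|[set c | hole x c]| = #|[set c | hole z c]|.
Proof.
have := cardsC [set c | hole z c]; rewrite -(cardsC [set c | hole x c]).
by rewrite !card_occupied => /addIn.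
Qed.

(** Both configurations have m^2 - n holes, so as long as the sets of holes differ
there are a hole of [z] occupied in [x] and a hole of [x] occupied in [z]; a
slide from the former to the latter fills one more hole correctly. *)
Lemma match_holes x z k :
  #|[set c | hole z c && ~~ hole x c]| <= k ->
  exists y, within (@config_adj n m) (k * (2 * m)) x y /\ hole y =1 hole z.
Proof.
elim: k x => [|k IH] x hk;
  have [/eqP/setP xz|] := boolP ([set c | hole x c] == [set c | hole z c]);
  try by exists x; split; [exact: within0 | move=> c; have := xz c; rewrite !inE].
  rewrite eq_sym eqEcard (card_holes z x) leqnn andbT => /subsetPn[a].
  rewrite !inE => za xa; move: hk; rewrite leqn0 cards_eq0 => /eqP/setP/(_ a).
  by rewrite !inE za xa.
move=> nxz; have /subsetPn[b] : ~~ ([set c | hole x c] \subset [set c | hole z c]).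
  by move: nxz; rewrite eqEcard (card_holes x z) leqnn andbT.
rewrite !inE => xb zb.
have /subsetPn[a] : ~~ ([set c | hole z c] \subset [set c | hole x c]).
  by move: nxz; rewrite eq_sym eqEcard (card_holes x z) leqnn andbT.
rewrite !inE => za xa.
have [p [pp pl sp]] := grid_path a b.
have [|x1 [xx1 h1]] := slide pp xa; first by rewrite pl.
have [|y [x1y hy]] := IH x1.
  rewrite -ltnS (leq_trans _ hk) // [ltnRHS](cardsD1 a) inE za xa ltnS.
  apply/subset_leq_card/fintype.subsetP => c; rewrite !inE h1 pl negb_or negb_and negbK.
  case/and3P=> zc -> /orP[-> //|/eqP cb]; first by rewrite zc.
  by rewrite cb (negbTE zb) in zc.
exists y; split => //; rewrite mulSn; apply: within_trans x1y.
exact: within_le xx1.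
Qed.

(** Run the gathering word w in both configurations.  The results differ by the
transposition of two pieces that now share a 2 x 2 block with the holes, and
the exchange in that block turns one into the other.  The constant is
2 * 24 for w and its inverse, and 2 for the four moves of the exchange, as
1 < m. *)
Lemma swap_pieces x y i j :
  1 < m -> (forall l, vcell (pos x l) \notin [:: (0, 0); (0, 1)]) ->
  i != j -> pos y i = pos x j -> pos y j = pos x i ->
  (forall l, l != i -> l != j -> pos y l = pos x l) ->
  within (@config_adj n m) (50 * m) x y.
Proof.
move=> m1 hpq ij yi yj yl.
(* The corner cells are named, to keep conversion from computing with them. *)
have [p p0] : exists p : pt, p = (0, 0) by exists (0, 0).
have [q q0] : exists q : pt, q = (0, 1) by exists (0, 1).
rewrite -p0 -q0 in hpq.
have inj u v : (vcell (pos x u) == vcell (pos x v)) = (u == v).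
  by rewrite (inj_eq (@vcell_inj m)) (inj_eq (@pos_inj _ _ x)).
have hx l : (vcell (pos x l) != p) && (vcell (pos x l) != q).
  by have := hpq l; rewrite !inE negb_or.
have hy l : (vcell (pos y l) != p) && (vcell (pos y l) != q).
  have [->|li] := eqVneq l i; first by rewrite yi.
  have [->|lj] := eqVneq l j; first by rewrite yj.
  by rewrite yl.
set s := vcell (pos x i); set t := vcell (pos x j).
have upqst : uniq [:: p; q; s; t].
  rewrite (uniq_catC [:: p; q] [:: s; t]) /= !inE !negb_or /s /t inj ij.
  have /andP[-> ->] := hx i; have /andP[-> ->] := hx j.
  by rewrite p0 q0.
have [w [lw sw [b [mb Bb]]]] := gather p0 q0 m1 upqst (vcell_box _) (vcell_box _).
have [] := exchange (p := act w p) (q := act w q) (s := act w s) (t := act w t) mb Bb.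
  by rewrite (map_inj_uniq (@act_inj w) [:: p; q; s; t]).
move=> w2 [lw2 sw2 ws wt wo].
have [x1 [xx1 x1E]] := run_word hx lw.
have [y1 [yy1 y1E]] := run_word hy lw.
have [|x2 [x12 x2E]] := run_word _ lw2 (x := x1).
  by move=> l; rewrite x1E !(inj_eq (@act_inj w)).
have -> : 50 * m = 24 * m + (2 * m + 24 * m) by lia.
apply: within_trans (within_le sw xx1) _.
apply: within_trans (within_le _ x12) _; first by lia.
suff -> : x2 = y1 by apply: within_sym (@config_adj_sym _ _) (within_le sw yy1).
apply: config_ext => l; apply: vcell_inj; rewrite x2E x1E y1E.
have [->|li] := eqVneq l i; first by rewrite yi.
have [->|lj] := eqVneq l j; first by rewrite yj.
rewrite yl // wo // (mem_map (@act_inj w) [:: p; q; s; t]) !inE !inj.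
rewrite (negbTE li) (negbTE lj) !orbF; have := hx l.
by rewrite -negb_or.
Qed.

(** Each transposition puts the piece [i] in its place; the piece [j] that stood
there was misplaced as well, so the number of misplaced pieces drops. *)
Lemma sort_pieces x y k :
  1 < m -> (forall l, vcell (pos x l) \notin [:: (0, 0); (0, 1)]) ->
  hole x =1 hole y -> #|[set i | pos x i != pos y i]| <= k ->
  within (@config_adj n m) (k * (50 * m)) x y.
Proof.
move=> m1; elim: k x => [|k IH] x hpq hxy hk;
  have [xy|[i]] := set_0Vmem [set i | pos x i != pos y i];
  try by (have -> : x = y by
     apply: config_ext => i; apply/eqP; have /setP/(_ i) := xy; rewrite !inE => /negbFE);
     exact: within0.
  by move=> ix; move: hk; rewrite leqn0 cards_eq0 => /eqP xy; rewrite xy inE in ix.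
rewrite inE => ix; have /holePn[j ji] : ~~ hole x (pos y i) by rewrite hxy holeF.
have ij : i != j by apply: contraNneq ix => e; rewrite -ji {1}e.
have [a b|z zE] := @config_of n m (fun l => pos x (tperm i j l)).
  by move/pos_inj/perm_inj.
have zi : pos z i = pos x j by rewrite zE tpermL.
have zj : pos z j = pos x i by rewrite zE tpermR.
have zl l : l != i -> l != j -> pos z l = pos x l.
  by move=> li lj; rewrite zE tpermD // eq_sym.
rewrite mulSn; apply: within_trans (swap_pieces m1 hpq ij zi zj zl) _.
apply: IH.
- by move=> l; rewrite zE.
- move=> c; rewrite -hxy; apply/forallP/forallP => h l.
    by have := h (tperm i j l); rewrite zE tpermK.
  by rewrite zE.
rewrite -ltnS (leq_trans _ hk) // [ltnRHS](cardsD1 i) inE ix ltnS.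
apply/subset_leq_card/fintype.subsetP => l; rewrite !inE.
have [->|li] := eqVneq l i; first by rewrite zi ji eqxx.
have [->|lj] /= := eqVneq l j; last by rewrite zl.
by rewrite ji (inj_eq (@pos_inj _ _ y)) ij.
Qed.

Lemma config_avoiding (a b : cell m) :
  n + 2 <= m ^ 2 -> exists z : config n m, hole z a && hole z b.
Proof.
move=> nm; have hA : n <= #|~: [set a; b]|.
  have := cardsC [set a; b]; rewrite card_prod !card_ord cards2 => e.
  by move: nm; rewrite -mulnn -e; case: (a != b); lia.
have [i j|z zE] := @config_of n m (fun i => enum_val (widen_ord hA i)).
  by move=> /enum_val_inj/(congr1 val)/= ?; exact: val_inj.
have h i : (pos z i != a) && (pos z i != b).
  by have := enum_valP (widen_ord hA i); rewrite -zE !inE negb_or.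
by exists z; apply/andP; split; apply/forallP => i; have /andP[] := h i.
Qed.

(** The constant 54 is 2 * 2 for the two slides to a common set of holes and 50
for the transpositions. *)
Lemma intrinsic_bound x y :
  n + 2 <= m ^ 2 -> within (@config_adj n m) (54 * (n * m)) x y.
Proof.
move=> nm; have m1 : 1 < m by case: m nm => [|[|?]]; lia.
have [a a0] : exists a : cell m, vcell a = (0, 0) by apply: vcell_ex; rewrite /box /=; lia.
have [b b0] : exists b : cell m, vcell b = (0, 1) by apply: vcell_ex; rewrite /box /=; lia.
have [z /andP[za zb]] := config_avoiding a b nm.
have cost u : exists v, within (@config_adj n m) (n * (2 * m)) u v /\ hole v =1 hole z.
  apply: match_holes; rewrite -[leqRHS](card_occupied u).
  by apply/subset_leq_card/fintype.subsetP => c; rewrite !inE => /andP[].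
have [x1 [xx1 hx1]] := cost x; have [y1 [yy1 hy1]] := cost y.
have -> : 54 * (n * m) = n * (2 * m) + (n * (50 * m) + n * (2 * m)) by lia.
apply: within_trans xx1 _; apply: within_trans (within_sym (@config_adj_sym _ _) yy1).
apply: sort_pieces => //.
- move=> l; rewrite !inE negb_or -a0 -b0 !(inj_eq (@vcell_inj m)).
  by rewrite !hole_neq // hx1.
- by move=> c; rewrite hx1 hy1.
- by rewrite (leq_trans (max_card _)) ?card_ord.
Qed.

End Upper.

(** * Distances and diameters *)

Lemma graph_dist_le (R : realType) (T : eqType) (e : rel T) k x y :
  within e k x y -> (graph_dist R e x y <= k%:R%:E)%E.
Proof.
move=> [p [ep lp sp]]; apply: (@le_trans _ _ (size p)%:R%:E).
  by apply: ereal_inf_lbound; exists p.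
by rewrite lee_fin ler_nat.
Qed.

(** A potential that drops by at most one along each edge and vanishes at the end
point bounds the length of every walk from below. *)
Lemma graph_dist_ge (R : realType) (T : eqType) (e : rel T) (f : T -> nat) x y :
  (forall u v, e u v -> f u <= (f v).+1) -> f y = 0 ->
  ((f x)%:R%:E <= graph_dist R e x y)%E.
Proof.
move=> fe fy; apply: le_ereal_inf_tmp => _ [p [ep lp] <-].
rewrite lee_fin ler_nat; elim: p x ep lp => [|u p IH] x /=.
  by move=> _ ->; rewrite fy.
case/andP=> xu ep lp; apply: leq_trans (fe _ _ xu) _.
by rewrite ltnS IH.
Qed.

Definition row_gap m (a b : cell m) : nat := (a.1 - b.1) + (b.1 - a.1).

Lemma row_gap_adj m (u v b : cell m) :
  cell_adj u v -> row_gap u b <= (row_gap v b).+1.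
Proof. by rewrite cell_adjE /adj /row_gap /=; lia. Qed.

Lemma row_gapxx m (b : cell m) : row_gap b b = 0.
Proof. by rewrite /row_gap subnn. Qed.

Lemma extrinsic_ge (R : realType) n m (x y : config n m) :
  ((\sum_(i < n) row_gap (pos x i) (pos y i))%:R%:E
     <= extrinsic_dist R x y)%E.
Proof.
rewrite natr_sum -sumEFin; apply: lee_sum => i _.
apply: (@graph_dist_ge _ _ _ (fun c => row_gap c (pos y i))); last exact: row_gapxx.
by move=> u v; exact: row_gap_adj.
Qed.

Lemma intrinsic_ge (R : realType) n m (x y : config n m) :
  ((\sum_(i < n) row_gap (pos x i) (pos y i))%:R%:E
     <= intrinsic_dist R x y)%E.
Proof.
apply: (@graph_dist_ge _ _ _
  (fun z : config n m => \sum_(i < n) row_gap (pos z i) (pos y i))); last first.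
  by rewrite big1 // => i _; exact: row_gapxx.
move=> u v /existsP[i /and3P[uv _ /forallP fixed]].
rewrite (bigD1 i) //= [X in _ <= X.+1](bigD1 i) //= -addSn leq_add //.
  exact: row_gap_adj.
by apply: leq_sum => j ji; rewrite (eqP (implyP (fixed j) ji)).
Qed.

(** The rows are rotated by m/2 modulo m: a row goes down by m/2 or, past the
boundary, up by m - m/2. *)
Lemma far_config n m (x : config n m) :
  exists y : config n m, forall i, m./2 <= row_gap (pos x i) (pos y i).
Proof.
have m0 (a : cell m) : 0 < m by exact: leq_ltn_trans (ltn_ord a.1).
pose f i := let a := pos x i in
  (Ordinal (ltn_pmod (a.1 + m./2) (m0 a)), a.2) : cell m.
have [i j|y yE] := @config_of n m f.
  move=> [/eqP + e2]; rewrite eqn_modDr !modn_small // => /eqP e1.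
  by apply: (@pos_inj _ _ x); apply: vcell_inj; rewrite /vcell e2; congr pair.
exists y => i; rewrite yE /row_gap /=.
have := ltn_ord (pos x i).1; move: (nat_of_ord (pos x i).1) => r rm.
have [h|h] := ltnP (r + m./2) m; first by rewrite modn_small; lia.
have -> : r + m./2 = (r + m./2 - m) + m by lia.
by rewrite modnDr modn_small; lia.
Qed.

Theorem proposition1 (R : realType) :
  exists c C : R,
    [/\ (0 < c)%R, (0 < C)%R &
      forall m n : nat, (0 < m)%N -> (n + 2 <= m ^ 2)%N ->
        [/\ ((c * (n * m)%:R)%:E <= diameter (@intrinsic_dist R n m))%E,
            (diameter (@intrinsic_dist R n m) <= (C * (n * m)%:R)%:E)%E,
            ((c * (n * m)%:R)%:E <= diameter (@extrinsic_dist R n m))%E &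
            (diameter (@extrinsic_dist R n m) <= (C * (n * m)%:R)%:E)%E]].
Proof.
(* m./2 is at least m / 3 for every m > 1, with equality for m = 3. *)
exists (3^-1)%R, 54%R; split; rewrite ?invr_gt0 ?ltr0n // => m n m0 nm.
have m1 : 1 < m by case: m m0 nm => [|[|?]] //; rewrite exp1n addn2.
have [a _] : exists a : cell m, vcell a = (0, 0) by apply: vcell_ex; rewrite /box m0.
have [x _] := config_avoiding a a nm.
have [y xy] := far_config x.
have gap : ((3^-1 * (n * m)%:R)%:E <=
    ((\sum_(i < n) row_gap (pos x i) (pos y i))%:R : R)%:E)%E.
  rewrite lee_fin ler_pdivrMl ?ltr0n // -natrM ler_nat.
  apply: (@leq_trans (3 * (n * m./2))); first by rewrite mulnCA leq_mul2l; apply/orP; right; lia.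
  rewrite leq_mul2l /= -{1}(card_ord n) -sum_nat_const.
  by apply: leq_sum => i _; exact: xy.
split.
- apply: le_trans gap _; apply: le_trans (intrinsic_ge R x y) _.
  by apply: ereal_sup_ubound; exists (x, y).
- apply: ge_ereal_sup => _ [[u v] _ <-] /=; rewrite -natrM.
  exact: graph_dist_le (intrinsic_bound u v nm).
- apply: le_trans gap _; apply: le_trans (extrinsic_ge R x y) _.
  by apply: ereal_sup_ubound; exists (x, y).
- apply: ge_ereal_sup => _ [[u v] _ <-] /=; rewrite -natrM.
  apply: (@le_trans _ _ (\sum_(i < n) (2 * m)%:R%:E)%E).
    by apply: lee_sum => i _; exact: graph_dist_le (grid_path _ _).
  rewrite sumEFin sumr_const card_ord lee_fin -mulrnA ler_nat.
  by lia.
Qed.
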